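(* Let $G=(V,E)$ be an undirected graph with vertex set $V=\{v_1,\ldots,v_n\}$ and $m=|E|$ edges. Let $D$ be an orientation of $G$ in which the out-degree of $v_i$ is $d_i$ for every $1\le i\le n$, and let $f:\{1,\ldots,n\}\to\mathbb{N}$ be given by $f(i)=d_i+1$. For every $1\le i\le n$ and every $1\le j\le d_i$ let $u^i_j$ be an arbitrary real number. Then $G$ is $f$-AT if and only if $$\sum_{A\subseteq E}(-1)^{|A|}\prod_{i=1}^n\prod_{j=1}^{d_i}\Big(\big(d^+_A(v_i)-d^-_A(v_i)\big)-u^i_j\Big)\neq 0,$$ where the sum ranges over all subsets $A$ of the arcs of $D$.
   Context: Identify $v_i$ with the index $i$. The graph polynomial of $G$ is $P_G(x_1,\ldots,x_n)=\prod_{i<j,\ (i,j)\in E}(x_i-x_j)$ (one factor per edge; $P_G\equiv 1$ if $E=\emptyset$). For $f:V\to\mathbb{N}^+$, $G$ is called Alon-Tarsi $f$-choosable ($f$-AT) if the expansion of $P_G$ contains a monomial $c\prod_{i=1}^n x_i^{t_i}$ with real coefficient $c\neq 0$ and $t_i\le f(i)-1$ for all $i$. For a set $A$ of arcs of $D$ and a vertex $v$, $d^+_A(v)$ is the number of arcs of $A$ with tail $v$ and $d^-_A(v)$ is the number of arcs of $A$ with head $v$. *)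

(* Defs.v *)
From HB Require Import structures.
From mathcomp Require Import all_boot all_order all_algebra.
From mathcomp Require Import reals.
From mathcomp Require Import mpoly.

Set Implicit Arguments.
Unset Strict Implicit.
Unset Printing Implicit Defensive.

Import GRing.Theory.
Local Open Scope ring_scope.

(* A graph is given by its adjacency relation, so an edge {i, j} is counted
   once by restricting to i < j. *)
Definition simple_graph (n : nat) (e : rel 'I_n) : Prop :=
  ssrbool.symmetric e /\ irreflexive e.

Definition graph_poly (R : realType) (n : nat) (e : rel 'I_n) : {mpoly R[n]} :=
  \prod_(p : 'I_n * 'I_n | (p.1 < p.2)%N && e p.1 p.2) ('X_p.1 - 'X_p.2).

(* [m i < f i] is [m i <= f i - 1] for the positive functions f considered;
   with truncated subtraction the latter would be wrong at f i = 0. *)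
Definition f_AT (R : realType) (n : nat) (e : rel 'I_n) (f : 'I_n -> nat) :
    Prop :=
  exists m : 'X_{1..n},
    (graph_poly R e)@_m != 0 /\ (forall i : 'I_n, (m i < f i)%N).

(* The arc (i, j) has tail i and head j. *)
Definition orientation (n : nat) (e : rel 'I_n) (D : {set 'I_n * 'I_n}) :
    Prop :=
  (forall i j : 'I_n, (i, j) \in D -> e i j) /\
  (forall i j : 'I_n, e i j -> ((i, j) \in D) (+) ((j, i) \in D)).

Definition outdeg (n : nat) (A : {set 'I_n * 'I_n}) (v : 'I_n) : nat :=
  #|[set a in A | a.1 == v]|.

Definition indeg (n : nat) (A : {set 'I_n * 'I_n}) (v : 'I_n) : nat :=
  #|[set a in A | a.2 == v]|.

(* Main.v *)
(** The sum is an iterated finite difference, of order m, of a product of m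
    affine forms, so inclusion-exclusion removes the constants u and leaves, up
    to sign, a permanent: rows are indexed by the m factors (i, j), columns by
    the arcs, and the entry at an arc is +1, -1 or 0 according as v_i is its
    tail, its head, or neither.  Grouping the permutations by the vertex they
    assign to each arc, the permanent is a positive multiple of the coefficient
    of x^d in the product of (x_tail - x_head) over the arcs, which is P_G up to
    sign.  As P_G is homogeneous of degree m = d_1 + ... + d_n, x^d is the only
    monomial that can witness that G is f-AT. *)

Require Import Defs.
From HB Require Import structures.
From mathcomp Require Import all_boot all_order all_fingroup all_algebra.
From mathcomp Require Import reals.
From mathcomp Require Import mpoly.

Import GRing.Theory.
Local Open Scope ring_scope.

(** * Inclusion-exclusion and permanents *)

Lemma sum_sign_supersets (R : numDomainType) (E : finType) (B : {set E}) :
  \sum_(A : {set E} | B \subset A) (-1) ^+ #|A| =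
  (if B == setT then (-1) ^+ #|E| else 0) :> R.
Proof.
case: eqVneq => [->|BT].
  by rewrite (big_pred1 setT) ?cardsT// => A; rewrite subTset.
have /existsP[a aB] : [exists a, a \notin B].
  rewrite -negb_forall; apply: contra BT => /forallP BT.
  by apply/eqP/setP => a; rewrite BT inE.
set S := LHS.
(* Toggling a fixed a outside B is a sign-reversing involution on the supersets of B. *)
pose h (A : {set E}) := if a \in A then A :\ a else a |: A.
have hK : involutive h.
  move=> A; rewrite /h; case: (boolP (a \in A)) => aA.
    by rewrite setD11 setD1K.
  by rewrite setU11 setU1K.
have SN : S = - S.
  rewrite {1}/S (reindex_inj (inv_inj hK)) /= -sumrN; apply: eq_big => A.
    rewrite /h; case: ifP => aA; first by rewrite subsetD1 aB andbT.
    by rewrite -subDset (setDidPl _) // disjoint_sym disjoints1.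
  rewrite /h; case: ifP => aA _; last by rewrite cardsU1 aA exprS mulN1r.
  by rewrite [in RHS](cardsD1 a) aA exprS mulN1r opprK.
have : S *+ 2 == 0 by rewrite mulr2n {2}SN subrr.
by rewrite Num.Theory.mulrn_eq0 => /eqP.
Qed.

Lemma big_option (R : nmodType) (E : finType) (Q : pred (option E))
    (F : option E -> R) : Q None ->
  \sum_(o | Q o) F o = F None + \sum_(a | Q (Some a)) F (Some a).
Proof.
move=> QN; rewrite (bigD1 None) //=; congr (_ + _).
rewrite (reindex_omap Some id) /=; last by case=> [a|] //; rewrite andbF.
by apply: eq_bigl => a; rewrite andbT eqxx andbT.
Qed.

Section InclusionExclusion.
Variables (R : numDomainType) (m : nat).
Variables (W : 'I_m -> 'I_m -> R) (u : 'I_m -> R).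

(** A selection records the summand picked from each factor when the product is expanded: [Some a]
    for [W s a], [None] for the constant [- u s]. *)
Let selection : Type := {ffun 'I_m -> option 'I_m}.

Let inA (A : {set 'I_m}) : pred (option 'I_m) :=
  fun o => if o is Some a then a \in A else true.

Let hit (g : selection) : {set 'I_m} := [set a | Some a \in codom g].

Let F s o := if o is Some a then W s a else - u s.

Let some_perm (p : {perm 'I_m}) : selection := [ffun s => Some (p s)].

Let some_perm_inj : injective some_perm.
Proof.
move=> p q /ffunP pq; apply/permP => s.
by have := pq s; rewrite !ffunE => -[].
Qed.

(** With only m factors to hit m arcs, there is no room for a constant or a repeated arc. *)
Let hitT (g : selection) : (hit g == setT) = (g \in some_perm @: setT).
Proof.
apply/eqP/imsetP => [gT|[p _ ->]]; last first.
  apply/setP => a; rewrite !inE; apply/codomP; exists ((p^-1)%g a).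
  by rewrite ffunE permKV.
have sub : Some @: [set: 'I_m] \subset g @: setT.
  apply/subsetP => _ /imsetP[a _ ->].
  have : a \in hit g by rewrite gT.
  by rewrite inE => /codomP[s ->]; apply: imset_f.
have cS : #|Some @: [set: 'I_m]| = m.
  by rewrite card_imset ?cardsT ?card_ord//; exact: Some_inj.
have cg : (#|g @: setT| <= m)%N.
  by rewrite (leq_trans (leq_imset_card _ _)) // cardsT card_ord.
have /eqP im : Some @: [set: 'I_m] == g @: setT by rewrite eqEcard sub cS.
have /imset_injP ginj : #|g @: setT| == #|[set: 'I_m]|.
  by rewrite -im cS cardsT card_ord.
have gS s : exists a, g s == Some a.
  have : g s \in g @: setT by apply: imset_f.
  by rewrite -im => /imsetP[a _ ->]; exists a.
pose p s := xchoose (gS s).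
have pE s : g s = Some (p s) by have /eqP := xchooseP (gS s).
have p_inj : injective p.
  by move=> s t st; apply: ginj; rewrite ?inE // !pE st.
exists (perm p_inj) => //; apply/ffunP => s.
by rewrite ffunE permE pE.
Qed.

(* Expanding the product assigns to every factor an arc or its constant; the
   signed sum over A kills every assignment that misses an arc. *)
Lemma signed_sum_permanent :
  \sum_(A : {set 'I_m}) (-1) ^+ #|A| * \prod_s (\sum_(a in A) W s a - u s) =
  (-1) ^+ m * \sum_(p : {perm 'I_m}) \prod_s W s (p s).
Proof.
have expand (A : {set 'I_m}) :
    (-1) ^+ #|A| * \prod_s (\sum_(a in A) W s a - u s) =
    \sum_(g in ffun_on (inA A)) (-1) ^+ #|A| * \prod_s F s (g s).
  rewrite -mulr_sumr -bigA_distr_big; congr (_ * _); apply: eq_bigr => s _.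
  by rewrite big_option //= addrC.
rewrite (eq_bigr _ (fun A _ => expand A)) (exchange_big_dep xpredT) //=.
(* A selection occurs in the expansion for A exactly when A contains every arc it hits, so after the
   exchange the inner sum runs over supersets of [hit g]. *)
have onE (g : selection) (A : {set 'I_m}) :
    (g \in ffun_on (inA A)) = (hit g \subset A).
  apply/ffun_onP/subsetP => [gA a|gA s].
    by rewrite inE => /codomP[s sa]; have := gA s; rewrite -sa.
  rewrite /in_mem /=; case E : (g s) => [a|//] /=.
  by apply: gA; rewrite inE -E codom_f.
under eq_bigr => g _ do
  rewrite -mulr_suml (eq_bigl _ _ (onE g)) sum_sign_supersets card_ord.
rewrite (bigID (fun g => hit g == setT)) /= [X in _ + X]big1 ?addr0; last first.
  by move=> g /negbTE ->; rewrite mul0r.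
rewrite (eq_bigl _ _ hitT) big_imset /=; last exact: in2W.
rewrite mulr_sumr; apply: eq_big => [p|p _]; first by rewrite inE.
rewrite ifT; last by rewrite hitT imset_f.
by congr (_ * _); apply: eq_bigr => s _; rewrite ffunE.
Qed.

End InclusionExclusion.

(** * Coefficients of products of linear forms *)

Definition fiber_sizes {n m : nat} (phi : 'I_m -> 'I_n) : 'X_{1..n} :=
  [multinom #|[set k | phi k == i]| | i < n].

Lemma fiber_sizesE n m (phi : 'I_m -> 'I_n) :
  fiber_sizes phi = (\sum_k U_(phi k))%MM.
Proof.
apply/mnmP => i; rewrite mnmE mnm_sumE -sum1_card.
rewrite [LHS]big_mkcond; apply: eq_bigr => k _.
by rewrite inE mnm1E; case: eqP.
Qed.

Lemma mdeg_fiber_sizes n m (phi : 'I_m -> 'I_n) : mdeg (fiber_sizes phi) = m.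
Proof.
rewrite fiber_sizesE mdeg_sum (eq_bigr (fun=> 1%N)) => [|k _]; last exact: mdeg1.
by rewrite sum_nat_const card_ord muln1.
Qed.

Section Coefficient.
Variables (R : comNzRingType) (n m : nat) (w : 'I_n -> 'I_m -> R).

Lemma mcoeff_prod_linear (t : 'X_{1..n}) :
  (\prod_k \sum_i w i k *: 'X_i)@_t =
  \sum_(phi : {ffun 'I_m -> 'I_n} | fiber_sizes phi == t) \prod_k w (phi k) k.
Proof.
rewrite bigA_distr_bigA /= raddf_sum [RHS]big_mkcond; apply: eq_bigr => phi _.
rewrite /= scaler_prod mprodXE -fiber_sizesE mcoeffZ mcoeffX.
by case: eqP => _; rewrite ?mulr1 ?mulr0.
Qed.

(** Equal fiber sizes mean that the two lists of values agree as multisets. *)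
Lemma fiber_sizes_perm (phi tau : 'I_m -> 'I_n) :
  fiber_sizes phi = fiber_sizes tau ->
  exists p : {perm 'I_m}, tau =1 phi \o p.
Proof.
move=> eqf.
have cnt (psi : 'I_m -> 'I_n) i :
    count_mem i [tuple psi k | k < m] = fiber_sizes psi i.
  rewrite mnmE /= count_map cardsE cardE size_filter enumT.
  exact: eq_count.
have /tuple_permP[p pE] :
    perm_eq [tuple tau k | k < m] [tuple phi k | k < m].
  by apply/allP => i _ /=; rewrite !cnt eqf.
exists p => k.
have := congr1 (fun s => nth (tau k) s k) pE.
by rewrite -!tnth_nth !tnth_mktuple.
Qed.

(* The permutations p with phi \o p = tau form a coset of the stabiliser of
   tau, so each phi is counted equally often in the permanent. *)
Lemma permanent_mcoeff (tau : 'I_m -> 'I_n) :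
  \sum_(p : {perm 'I_m}) \prod_s w (tau s) (p s) =
  (\prod_k \sum_i w i k *: 'X_i)@_(fiber_sizes tau) *+
    #|[set q : {perm 'I_m} | [forall s, tau (q s) == tau s]]|.
Proof.
(* Under [lab p], the arc [p s] receives the vertex of the factor s matched with it. *)
pose lab (p : {perm 'I_m}) : {ffun 'I_m -> 'I_n} := [ffun k => tau ((p^-1)%g k)].
have labE p : fiber_sizes (lab p) = fiber_sizes tau.
  rewrite !fiber_sizesE [LHS](reindex_inj (@perm_inj _ p)) /=.
  by apply: eq_bigr => k _; rewrite ffunE permK.
rewrite mcoeff_prod_linear -sumrMnl.
rewrite (partition_big lab (fun phi => fiber_sizes phi == fiber_sizes tau)) /=;
  last by move=> p _; rewrite labE.
apply: eq_bigr => phi /eqP /fiber_sizes_perm[p1 p1E].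
rewrite (eq_bigr (fun=> \prod_k w (phi k) k)); last first.
  move=> p /eqP <-; rewrite [RHS](reindex_inj (@perm_inj _ p)) /=.
  by apply: eq_bigr => s _; rewrite ffunE permK.
rewrite sumr_const; congr (_ *+ _).
rewrite -[RHS](card_imset _ (mulIg p1)); apply: eq_card => p.
rewrite -(mulgKV p1 p); set q := (p * p1^-1)%g.
rewrite (mem_imset _ _ (mulIg p1)) in_set.
transitivity (lab (q * p1)%g == phi) => [//|].
(* In [q * p1] the permutation q acts first, so the left side says that [tau] is [phi \o p1 \o q],
   that is, [tau \o q]. *)
apply/eqP/forallP => [labp s|tauq].
  by rewrite p1E /= -labp ffunE -[p1 (q s)]permM permK.
apply/ffunP => k; rewrite ffunE -(eqP (tauq _)) p1E /= -[p1 (q _)]permM.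
by rewrite permKV.
Qed.

End Coefficient.

(** * Orientations, degrees and the criterion *)

Lemma graph_poly_orientation {R : realType} {n : nat} {e : rel 'I_n}
    {D : {set 'I_n * 'I_n}} :
  simple_graph e -> orientation e D ->
  exists c : nat,
    graph_poly R e = (-1) ^+ c * \prod_(a in D) ('X_a.1 - 'X_a.2).
Proof.
move=> [e_sym e_irr] [De eD].
pose swap (a : 'I_n * 'I_n) := (a.2, a.1).
(* [orient] and [sort] are mutually inverse between the edges listed as i < j and the arcs of
   [D]. *)
pose orient a := if a \in D then a else swap a.
pose sort (a : 'I_n * 'I_n) := if (a.1 < a.2)%N then a else swap a.
have D_anti a : a \in D -> swap a \notin D.
  by case: a => i j ijD; have := eD _ _ (De _ _ ijD); rewrite ijD.
have D_neq a : a \in D -> a.1 != a.2.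
  case: a => i j ijD /=; apply/eqP => ij.
  by have := De _ _ ijD; rewrite ij e_irr.
(* The exponent counts the edges i < j whose arc runs from j to i; exactly these factors change
   sign. *)
exists (\sum_(p : 'I_n * 'I_n | (p.1 < p.2)%N && e p.1 p.2) (p \notin D))%N.
rewrite -prodrXr [X in _ * X](reindex_onto orient sort) /=; last first.
  move=> a aD; rewrite /sort; case: ifP => _; rewrite /orient ?aD //.
  by rewrite (negbTE (D_anti _ aD)); case: (a).
rewrite [X in _ * X](eq_bigl
  (fun p : 'I_n * 'I_n => (p.1 < p.2)%N && e p.1 p.2)) => [|p].
  rewrite -big_split /=; apply: eq_bigr => p _.
  by rewrite /orient; case: ifP => _ /=; rewrite ?mul1r // expr1 mulN1r opprB.
rewrite /orient /sort; case: p => i j /=; case ijD : ((i, j) \in D) => /=.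
  rewrite ijD (De _ _ ijD) andbT; case: ifP => ij; rewrite ?eqxx//.
  by apply/eqP => -[ji _]; have := D_neq _ ijD; rewrite /= ji eqxx.
case eij : (e i j); last first.
  rewrite andbF; apply/negbTE/negP => /andP[jiD _].
  by have := De _ _ jiD; rewrite e_sym eij.
have jiD : (j, i) \in D by have := eD _ _ eij; rewrite ijD.
rewrite jiD andbT /=; have := D_neq _ jiD; rewrite -val_eqE /= => ji.
case: ltngtP ji => // ij _; rewrite ?eqxx //.
by apply/eqP => -[ij' _]; rewrite ij' ltnn in ij.
Qed.

Lemma outdeg_sub_indeg (R : pzRingType) n (A : {set 'I_n * 'I_n}) (i : 'I_n) :
  (outdeg A i)%:R - (indeg A i)%:R =
  \sum_(a in A) ((a.1 == i)%:R - (a.2 == i)%:R) :> R.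
Proof.
have deg (q : pred ('I_n * 'I_n)) :
    #|[set a in A | q a]|%:R = \sum_(a in A) (q a)%:R :> R.
  rewrite -sum1_card natr_sum [RHS](bigID q) /= [X in _ + X]big1 ?addr0 => [|a].
    apply: eq_big => a; first by rewrite inE.
    by rewrite inE => /andP[_ ->].
  by case/andP=> _ /negbTE ->.
by rewrite sumrB /outdeg /indeg !deg.
Qed.

Lemma sum_outdeg n (D : {set 'I_n * 'I_n}) : \sum_i outdeg D i = #|D|.
Proof.
rewrite -sum1_card (partition_big fst xpredT) //=; apply: eq_bigr => i _.
by rewrite /outdeg -sum1_card; apply: eq_bigl => a; rewrite inE.
Qed.

Theorem theorem1p5 (R : realType) (n : nat) (e : rel 'I_n)
    (G_simple : simple_graph e)
    (D : {set 'I_n * 'I_n}) (D_orientation : orientation e D)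
    (d : 'I_n -> nat) (d_outdeg : forall i : 'I_n, outdeg D i = d i)
    (f : 'I_n -> nat) (fE : forall i : 'I_n, f i = (d i + 1)%N)
    (u : forall i : 'I_n, 'I_(d i) -> R) :
  f_AT R e f <->
  \sum_(A : {set 'I_n * 'I_n} | A \subset D)
     (-1) ^+ #|A| *
     (\prod_(i < n) \prod_(j < d i)
        (((outdeg A i)%:R - (indeg A i)%:R) - u i j)) != 0.
Proof.
pose m := #|D|.
pose arc (k : 'I_m) : 'I_n * 'I_n := enum_val k.
pose w (i : 'I_n) (k : 'I_m) : R := ((arc k).1 == i)%:R - ((arc k).2 == i)%:R.
have sum_d : (\sum_i d i)%N = m.
  by rewrite /m -sum_outdeg; apply: eq_bigr => i _; rewrite d_outdeg.
(* The factors (i, j) number m in total, as many as the arcs, so both can be indexed by ['I_m] and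
   the matrix is square; [tau] gives the vertex owning a factor. *)
pose slotT : finType := {i : 'I_n & 'I_(d i)}.
have card_slot : m = #|slotT| by rewrite tagnat.card.
pose slot (k : 'I_m) : slotT := enum_val (cast_ord card_slot k).
have slot_bij : bijective slot.
  apply: inj_card_bij => [k l /enum_val_inj/cast_ord_inj //|].
  by rewrite card_ord card_slot.
pose tau k : 'I_n := tag (slot k).
have tau_fibers i : fiber_sizes tau i = d i.
  rewrite mnmE -sum1_card big_mkcond /=.
  rewrite (eq_bigr (fun k => (tag (slot k) == i) : nat)) => [|k _]; last first.
    by rewrite inE /tau; case: eqP.
  rewrite -(reindex slot (F := fun s => (tag s == i) : nat) (P := xpredT)) /=;
    last exact: onW_bij.
  rewrite -(sig_big_dep xpredT (fun _ => xpredT)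
    (fun i' (_ : 'I_(d i')) => (i' == i) : nat)) /=.
  rewrite (bigD1 i) //= [X in (_ + X)%N]big1 => [|i' /negbTE ->]; last by rewrite big1.
  by rewrite eqxx sum_nat_const card_ord muln1 addn0.
have [c graphE] := graph_poly_orientation (R := R) G_simple D_orientation.
have coefE t : ((graph_poly R e)@_t != 0) =
    ((\prod_k \sum_i w i k *: 'X_i)@_t != 0).
  rewrite graphE -signr_odd mulr_sign; set P := (X in if _ then - X else X).
  have -> : P = \prod_k \sum_i w i k *: 'X_i.
    rewrite /P big_enum_val /=; apply: eq_bigr => k _.
    rewrite (eq_bigr _ (fun i _ => scalerBl _ _ _)) sumrB.
    have single (v : 'I_n) : 'X_v = \sum_i (v == i)%:R *: 'X_i :> {mpoly R[n]}.
      rewrite (bigD1 v) //= eqxx scale1r big1 ?addr0 // => i.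
      by rewrite eq_sym => /negbTE ->; rewrite scale0r.
    by rewrite [in LHS](single (_.1)) [in LHS](single (_.2)).
  by case: ifP => _; rewrite ?mcoeffN ?oppr_eq0.
set S := (X in _ <-> X != 0).
have SE : S = \sum_(A : {set 'I_m}) (-1) ^+ #|A| *
    \prod_s (\sum_(a in A) w (tau s) a - u (tau s) (tagged (slot s))).
  (* Subsets of [D] are the images under [arc] of sets of indices. *)
  rewrite /S (reindex_onto (fun A : {set 'I_m} => arc @: A)
    (fun A => arc @^-1: A)) /=; last first.
    move=> A /subsetP AD; apply/setP => a; apply/imsetP/idP => [[k]|aA].
      by rewrite inE => kA ->.
    have aD := AD a aA.
    by exists (enum_rank_in aD a); rewrite ?inE /arc enum_rankK_in.
  have arc_inj : injective arc by exact: enum_val_inj.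
  apply: eq_big => [A|A _].
    have -> : arc @^-1: (arc @: A) = A.
      by apply/setP => k; rewrite inE mem_imset.
    rewrite eqxx andbT; apply/subsetP => _ /imsetP[k _ ->].
    exact: enum_valP.
  rewrite card_imset //; congr (_ * _).
  rewrite (sig_big_dep xpredT (fun _ => xpredT)
    (fun i j => (outdeg (arc @: A) i)%:R - (indeg (arc @: A) i)%:R - u i j)).
  rewrite (reindex slot) /=; last exact: onW_bij.
  apply: eq_bigr => s _; rewrite outdeg_sub_indeg big_imset //.
  exact: in2W.
have -> : (S != 0) = ((graph_poly R e)@_(fiber_sizes tau) != 0).
  rewrite coefE SE (signed_sum_permanent _ _ (fun s => w (tau s))).
  (* The multiplicity is the order of the stabiliser of [tau], which contains the identity; being
     positive, it cannot annihilate a nonzero coefficient in characteristic 0. *)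
  rewrite permanent_mcoeff mulf_eq0 signr_eq0 /= Num.Theory.mulrn_eq0.
  rewrite negb_or -lt0n; case: card_gt0P => // -[]; exists 1%g.
  by rewrite inE; apply/forallP => s; rewrite perm1.
split=> [[t [tN0 t_lt]]|tauN0]; last first.
  by exists (fiber_sizes tau); split=> // i; rewrite tau_fibers fE addn1.
suff <- : t = fiber_sizes tau by [].
have t_le i : (t i <= d i)%N by have := t_lt i; rewrite fE addn1 ltnS.
have deg_t : mdeg t = m.
  apply: contraNeq tN0 => deg_t; rewrite -[_ == 0]negbK coefE negbK.
  rewrite mcoeff_prod_linear big1 // => phi /eqP phit.
  by rewrite -phit mdeg_fiber_sizes eqxx in deg_t.
(* [t] is bounded by [d] pointwise and both sum to m, so equality holds at every vertex. *)
have [_] := leqif_sum (P := xpredT) (fun i _ => leqif_eq (t_le i)).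
rewrite -mdegE deg_t sum_d eqxx => /esym/forallP t_eq.
by apply/mnmP => i; rewrite tau_fibers; exact: (eqP (t_eq i)).
Qed.
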